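(* With $\Gamma$ graded by path length and quasi-hereditary with respect to $\le$, $\Gamma$ is standard Koszul: $\operatorname{Ext}^i_{\mathsf{gr}\Gamma}(\Delta,\Gamma_0\langle j\rangle)=0$ whenever $i\neq j$; equivalently, every standard module $\Delta_x$ (placed with its top in degree $0$) has a linear graded projective resolution.
   Context: Let $k$ be an algebraically closed field; modules are finitely generated right modules; for arrows $\alpha,\beta$ the product $\alpha\beta$ is the path traversing $\alpha$ first and then $\beta$; $e_x$ is the trivial path at $x$, $P_x=e_x\Gamma$, $S_x$ its simple top. For integers $n\ge1$, $m\ge1$, let $Q^{(n,m)}$ be the quiver whose vertices are the tuples $x=(x_0,\dots,x_n)\in\mathbb{Z}_{\ge0}^{n+1}$ with $\sum_i x_i=m-1$, with an arrow $\alpha_i:x\to x+f_i$ for each $i\in\{0,\dots,n\}$ and each vertex $x$ such that $x+f_i$ is a vertex; here for $1\le i\le n$ the vector $f_i\in\mathbb{Z}^{n+1}$ has entry $-1$ in position $i-1$, $+1$ in position $i$, $0$ elsewhere, and $f_0=(1,0,\dots,0,-1)$. The higher zigzag algebra $Z^n_m$ is $kQ^{(n,m)}$ modulo the relations: for every vertex $x$ and $i,j\in\{0,\dots,n\}$ such that $x+f_i$ and $x+f_i+f_j$ are vertices, the path $x\xrightarrow{\alpha_i}x+f_i\xrightarrow{\alpha_j}x+f_i+f_j$ is zero if $i=j$, and equals the path $x\xrightarrow{\alpha_j}x+f_j\xrightarrow{\alpha_i}x+f_i+f_j$ if $i\neq j$ and $x+f_j$ is a vertex. Fix $n\ge1$,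 $s\ge1$, put $Z^+=Z^n_{s+1}$, let $I$ be the vertex set of $Q^{(n,s+1)}$, $K=\{x\in I:x_0=0\}$, and $\Gamma=Z^+/(e_z\alpha_0\alpha_1 : z\in K)$, i.e. $Z^+$ modulo the additional relations that every path starting at a vertex of $K$ consisting of an arrow $\alpha_0$ followed by an arrow $\alpha_1$ is zero. Partially order $I$ by $x\le y$ iff there is a path from $x$ to $y$ in $Q^{(n,s+1)}$ using no arrow $\alpha_0$; the standard module $\Delta_x$ is the largest quotient of $P_x$ with no composition factor $S_y$, $y>x$, and $\Delta=\bigoplus_x\Delta_x$; $\Gamma$ is quasi-hereditary for this order. $\Gamma$ is graded by path length, $\Gamma_0=\bigoplus_x ke_x$; $\mathsf{gr}\Gamma$ denotes finitely generated graded modules with degree-zero morphisms, $(M\langle j\rangle)_i=M_{i-j}$. A graded module $M$ is linear if it has a graded projective resolution $\cdots\to P^1\to P^0\to M\to0$ with each $P^i$ generated in degree $i$. *)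

(* Defs.v *)
From HB Require Import structures.
From mathcomp Require Import all_boot all_order all_algebra.
Unset Implicit Arguments. Unset Printing Implicit Defensive.
Import Order.TTheory GRing.Theory Num.Theory.
Local Open Scope ring_scope.

Definition vtxT (n : nat) := 'rV[int]_(n.+1).

(* x is a vertex of Q^(n,m) with m = s+1: x_i >= 0 and sum x_i = m - 1 = s. *)
Definition isv (n s : nat) (x : vtxT n) : bool :=
  [forall j, (0 <= x 0 j)] && (\sum_j x 0 j == (s%:Z)).

Arguments isv {n} s x.
Definition fvec (n : nat) (i : 'I_n.+1) : vtxT n :=
  \row_(j < n.+1)
    (if (i : nat) == 0%N
     then ((j : nat) == 0%N)%:R - ((j : nat) == n)%:R
     else ((j : nat) == i)%:R - ((j : nat).+1 == i)%:R).

Arguments fvec {n} i.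
(* Partial order on vertices: x <= y iff there is a path from x to y in the
   quiver using no arrow alpha_0 (all intermediate points being vertices). *)
Inductive qle (n s : nat) : vtxT n -> vtxT n -> Prop :=
| qle_refl x : qle n s x x
| qle_step x (i : 'I_n.+1) y :
    (i : nat) != 0%N -> isv s (x + fvec i) -> qle n s (x + fvec i) y -> qle n s x y.
Arguments qle {n} s _ _.
Arguments qle_refl {n s} x.
Arguments qle_step {n s} x i y _ _ _.

Definition qlt (n s : nat) (x y : vtxT n) : Prop := qle s x y /\ x <> y.

Arguments qlt {n} s x y.
(* ---------- Graded right Gamma-modules (as graded representations) ----------
   A finite-dimensional graded right module over Gamma = kQ/I (Gamma graded by
   path length) is encoded via a homogeneous basis adapted to the decomposition
   M = (+)_x M e_x: basis vector p lies in M e_(gvtx p) and has degree gdeg p.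
   Vectors are row vectors; the right action of the arrows alpha_i (for all
   source vertices at once) is the matrix gact i, acting by v |-> v *m gact i. *)
Record gmod (k : fieldType) (n : nat) := GMod {
  gdim : nat;
  gvtx : 'I_gdim -> vtxT n;
  gdeg : 'I_gdim -> int;
  gact : 'I_n.+1 -> 'M[k]_gdim
}.
Arguments GMod {k n} gdim gvtx gdeg gact.
Arguments gdim {k n} g.
Arguments gvtx {k n} g _.
Arguments gdeg {k n} g _.
Arguments gact {k n} g _.

Definition idem (k : fieldType) (n : nat) (M : gmod k n) (x : vtxT n) : 'M[k]_(gdim M) :=
  \matrix_(p, q) ((p == q) && (gvtx M p == x))%:R.

Arguments idem {k n} M x.
Definition degmx (k : fieldType) (n : nat) (M : gmod k n) (d : int) : 'M[k]_(gdim M) :=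
  \matrix_(p, q) ((p == q) && (gdeg M p == d))%:R.

Arguments degmx {k n} M d.
(* Validity: basis vectors sit at vertices, arrows alpha_i : x -> x + f_i
   raise degree by one, and the relations of Gamma hold:
   - alpha_i alpha_i = 0,
   - e_x alpha_i alpha_j = e_x alpha_j alpha_i when i <> j and x + f_i,
     x + f_j, x + f_i + f_j are vertices,
   - e_z alpha_0 alpha_1 = 0 for z in K (z_0 = 0). *)
Definition is_gmod (k : fieldType) (n s : nat) (M : gmod k n) : Prop :=
  [/\ (forall p, isv s (gvtx M p)),
      (forall (i : 'I_n.+1) p q, gact M i p q != 0 ->
          gvtx M q = gvtx M p + fvec i /\ gdeg M q = gdeg M p + 1),
      (forall i, gact M i *m gact M i = 0),
      (forall (x : vtxT n) (i j : 'I_n.+1), isv s x -> i != j ->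
          isv s (x + fvec i) -> isv s (x + fvec j) -> isv s (x + fvec i + fvec j) ->
          idem M x *m gact M i *m gact M j = idem M x *m gact M j *m gact M i) &
      (forall z : vtxT n, isv s z -> z 0 0 = 0 ->
          idem M z *m gact M 0 *m gact M (inord 1) = 0)].

Arguments is_gmod {k n} s M.
Definition is_mor (k : fieldType) (n : nat) (M1 M2 : gmod k n)
    (F : 'M[k]_(gdim M1, gdim M2)) : Prop :=
  (forall p q, F p q != 0 -> gvtx M1 p = gvtx M2 q /\ gdeg M1 p = gdeg M2 q) /\
  (forall i, gact M1 i *m F = F *m gact M2 i).

Arguments is_mor {k n} M1 M2 F.
Definition is_proj (k : fieldType) (n s : nat) (P : gmod k n) : Prop :=
  forall (M M' : gmod k n) (g : 'M[k]_(gdim M, gdim M')) (h : 'M[k]_(gdim P, gdim M')),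
    is_gmod s M -> is_gmod s M' -> is_mor M M' g -> row_full g -> is_mor P M' h ->
    exists l : 'M[k]_(gdim P, gdim M), is_mor P M l /\ l *m g = h.

Arguments is_proj {k n} s P.
(* M is generated in degree d: M = M_d Gamma, i.e. M lives in degrees >= d and
   M = M_d + (sum of the images of the arrows). *)
Definition gen_in_deg (k : fieldType) (n : nat) (M : gmod k n) (d : int) : Prop :=
  (forall p, d <= gdeg M p) /\
  row_full (degmx M d + \sum_(i < n.+1) gact M i)%MS.

Arguments gen_in_deg {k n} M d.
(* P is (isomorphic to) the graded indecomposable projective P_x = e_x Gamma
   with its top S_x in degree 0. *)
Definition is_Px (k : fieldType) (n s : nat) (P : gmod k n) (x : vtxT n) : Prop :=
  [/\ is_gmod s P, is_proj s P, gen_in_deg P 0,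
      #|[pred p | gdeg P p == 0]| = 1%N &
      (forall p, gdeg P p = 0 -> gvtx P p = x)].

Arguments is_Px {k n} s P x.
(* M has no composition factor S_y (in any degree) with y > x. *)
Definition no_factor_above (k : fieldType) (n s : nat) (M : gmod k n) (x : vtxT n) : Prop :=
  forall p, ~ qlt s x (gvtx M p).

Arguments no_factor_above {k n} s M x.
Definition is_std (k : fieldType) (n s : nat) (P : gmod k n) (x : vtxT n)
    (D : gmod k n) (pi : 'M[k]_(gdim P, gdim D)) : Prop :=
  [/\ is_gmod s D, is_mor P D pi, row_full pi, no_factor_above s D x &
      forall (D' : gmod k n) (pi' : 'M[k]_(gdim P, gdim D')),
        is_gmod s D' -> is_mor P D' pi' -> row_full pi' -> no_factor_above s D' x ->
        exists g : 'M[k]_(gdim D, gdim D'), is_mor D D' g /\ pi *m g = pi'].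

Arguments is_std {k n} s P x D pi.
Definition has_linear_resolution (k : fieldType) (n s : nat) (M : gmod k n) : Prop :=
  exists (R : nat -> gmod k n)
         (d : forall i : nat, 'M[k]_(gdim (R i.+1), gdim (R i)))
         (eps : 'M[k]_(gdim (R 0%N), gdim M)),
    [/\ forall i, is_gmod s (R i) /\ is_proj s (R i) /\ gen_in_deg (R i) i%:Z,
        forall i, is_mor (R i.+1) (R i) (d i),
        is_mor (R 0%N) M eps /\ row_full eps,
        (d 0%N == kermx eps)%MS &
        forall i, (d i.+1 == kermx (d i))%MS].


Arguments has_linear_resolution {k n} s M.

(* Main.v *)
(* Since alpha_i with i != 0 increases x, Delta_x has basis e_x, e_x alpha_0 (the
   latter if x_n > 0). The projective at y has as basis the commutation classes of
   paths using each arrow of a set S at most once. Delta_x is resolved by a Koszul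
   type complex whose r-th term is the sum of the projectives at x + sum_i c_i f_i
   (i = 1..n) over c with |c| = r and c_i <= x_(i-1), with differential
   (c, S) -> sum_(j notin S) +-(c - e_j, S + j). It preserves c + 1_S, so it splits
   into cubes, each of which is contractible unless c + 1_S vanishes on 1..n. *)
Require Import Defs.
From HB Require Import structures.
From mathcomp Require Import all_boot all_order all_algebra.
From mathcomp Require Import zify ring.
Import Order.TTheory GRing.Theory Num.Theory.
Local Open Scope ring_scope.
Set Implicit Arguments.
Unset Strict Implicit.
Unset Printing Implicit Defensive.

(** P and D are known only through their universal properties, so D is compared with the explicit
    [Std]: P surjects onto [Std], this surjection factors through D, and a dimension bound on D
    makes D -> Std bijective. The main obstacle is the projectivity of the explicit terms. A map out
    of such a term must be defined by multiplying arrows, but alpha_l alpha_j = alpha_j alpha_l is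
    imposed only when both intermediate points are vertices. A fixed order of the arrows keeps all
    prefixes admissible and avoids the one kind of swap that may fail. The bound c_i <= x_(i-1) says
    that no unit of x is moved twice by the f_i. A contraction must respect it; raising c at the
    smallest index in play does, because nothing enters the preceding position. *)

(** * Vertices and the vectors f_i *)

Section Vertices.
Variables (n s : nat).

(** Reading positions cyclically removes the special case of f_0, and sums over positions can be
    reindexed by [ordS]. *)
Lemma fvecE (i p : 'I_n.+1) :
  fvec i 0 p = (p == i)%:R - (ordS p == i)%:R.
Proof.
rewrite mxE -!val_eqE /=; case: (val i =P 0%N) => [->|i0].
  congr (_ - _%:R); case: (eqVneq (p : nat) n) => [->|pn]; first by rewrite modnn.
  by rewrite modn_small; have := ltn_ord p; lia.
congr (_ - _%:R); case: (eqVneq (p : nat) n) => [->|pn].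
  by rewrite modnn; have := ltn_ord i; have : (i : nat) <> 0%N := i0; lia.
by rewrite modn_small; have := ltn_ord p; lia.
Qed.

Lemma addvE (v w : vtxT n) p : (v + w) 0 p = v 0 p + w 0 p.
Proof. by rewrite mxE. Qed.

Lemma sum_fvec (i : 'I_n.+1) : \sum_j fvec i 0 j = 0.
Proof.
under eq_bigr => j _ do rewrite fvecE.
rewrite sumrB [X in X - _](reindex_inj (@ordS_inj n.+1)) subrr //.
Qed.

Lemma isv_ge0 (v : vtxT n) p : isv s v -> 0 <= v 0 p.
Proof. by case/andP => /forallP. Qed.

Lemma isv_fvecP (v : vtxT n) i :
  isv s v -> isv s (v + fvec i) = [forall p, 0 <= v 0 p + fvec i 0 p].
Proof.
case/andP=> _ /eqP Hs; rewrite /isv.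
under [\sum_j _]eq_bigr => j _ do rewrite mxE.
rewrite big_split /= sum_fvec addr0 Hs eqxx andbT.
by apply: eq_forallb => p; rewrite mxE.
Qed.

Lemma ordS_neq (p : 'I_n.+1) : (0 < n)%N -> ordS p != p.
Proof.
move=> hn; rewrite -val_eqE /=; case: (eqVneq (p : nat) n) => [->|pn].
  by rewrite modnn; lia.
by rewrite modn_small; have := ltn_ord p; lia.
Qed.

(** Among the arrows other than alpha_0 only alpha_1 touches position 0, and it takes a unit away.
    Hence x + f_0, which gains one there when n > 0, is never above x. *)
Lemma qle_coord0 (v w : vtxT n) : qle s v w -> w 0 0 <= v 0 0.
Proof.
elim=> // u i y i0 _ _ IH; apply: le_trans IH _.
rewrite mxE fvecE; case: eqP => [E|_]; first by rewrite -E in i0.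
by case: (_ == _) => /=; lia.
Qed.

End Vertices.

(** * Homogeneous elements, commutation of arrows, generation in one degree *)

Section Homogeneous.
Variables (k : fieldType) (n s : nat).

Definition homog (M : gmod k n) (v : vtxT n) (d : int) (u : 'rV[k]_(gdim M)) :=
  forall q, u 0 q != 0 -> gvtx M q = v /\ gdeg M q = d.

Lemma homog0 (M : gmod k n) v d : @homog M v d 0.
Proof. by move=> q; rewrite mxE eqxx. Qed.

Lemma homog_add (M : gmod k n) v d u w : @homog M v d u -> homog v d w -> homog v d (u + w).
Proof.
move=> Hu Hw q; rewrite mxE => H.
by case: (eqVneq (u 0 q) 0) => [E|/Hu //]; apply: Hw; rewrite E add0r in H.
Qed.

Lemma homog_scale (M : gmod k n) v d a u : @homog M v d u -> homog v d (a *: u).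
Proof. by move=> Hu q; rewrite mxE mulf_eq0 negb_or => /andP[_ /Hu]. Qed.

Lemma homog_mul (M1 M2 : gmod k n) (F : 'M[k]_(gdim M1, gdim M2)) v d w e u :
  (forall p q, F p q != 0 -> gvtx M1 p = v -> gdeg M1 p = d ->
     gvtx M2 q = w /\ gdeg M2 q = e) ->
  @homog M1 v d u -> @homog M2 w e (u *m F).
Proof.
move=> HF Hu q; rewrite mxE => H.
have [p Hp] : exists p, u 0 p * F p q != 0.
  apply/existsP; apply: contraNT H; rewrite negb_exists => /forallP H.
  by rewrite big1 // => p _; apply/eqP; have := H p; rewrite negbK.
move: Hp; rewrite mulf_eq0 negb_or => /andP[/Hu [E1 E2] Hp].
exact: (HF _ _ Hp).
Qed.

Lemma homog_act (M : gmod k n) v d u i : is_gmod s M -> @homog M v d u ->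
  @homog M (v + fvec i) (d + 1) (u *m gact M i).
Proof. by case=> _ H _ _ _; apply: homog_mul => p q /H [-> ->] -> ->. Qed.

Lemma homog_mor (M1 M2 : gmod k n) F v d u :
  is_mor M1 M2 F -> @homog M1 v d u -> @homog M2 v d (u *m F).
Proof. by case=> H _; apply: homog_mul => p q /H [-> ->]. Qed.

(** Paths that leave the quiver can thus be written down formally: their value is zero. *)
Lemma homog_not_vertex (M : gmod k n) v d u : is_gmod s M -> @homog M v d u ->
  ~~ isv s v -> u = 0.
Proof.
case=> H _ _ _ _ Hu Hv; apply/rowP => q; rewrite mxE.
by apply/eqP; apply: contraNT Hv => /Hu [<- _].
Qed.

Lemma homog_idem (M : gmod k n) v d u : @homog M v d u -> u *m idem M v = u.
Proof.
move=> Hu; apply/rowP => q; rewrite mxE (bigD1 q) //= big1 ?addr0.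
  rewrite mxE eqxx /=; case: eqP => [_|H]; first by rewrite mulr1.
  by rewrite mulr0; apply/esym/eqP; apply: contra_notT H => /Hu [].
by move=> p /negPf pq; rewrite mxE pq mulr0.
Qed.

(** If v + f_j is not a vertex, the position p before j is empty in v and the right side vanishes.
    The left side can survive only if alpha_l fills p first, i.e. l = p and j = [ordS l]. For l = 0
    this is the extra relation of Gamma at a vertex of K; for l != 0 it is the excluded case. *)
Lemma homog_swap (M : gmod k n) v d u (l j : 'I_n.+1) : (0 < n)%N -> is_gmod s M -> @homog M v d u ->
  isv s v -> isv s (v + fvec l) -> l != j -> (l == 0) || (j != ordS l) ->
  u *m gact M l *m gact M j = u *m gact M j *m gact M l.
Proof.
move=> hn HM Hu Hv Hl lj Hc.
have Z : ~~ isv s (v + fvec l + fvec j) ->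
    u *m gact M l *m gact M j = u *m gact M j *m gact M l.
  move=> N; rewrite (homog_not_vertex HM (homog_act (i := j) HM (homog_act (i := l) HM Hu)) N).
  rewrite addrAC in N.
  by rewrite (homog_not_vertex HM (homog_act (i := l) HM (homog_act (i := j) HM Hu)) N).
case: (boolP (isv s (v + fvec l + fvec j))) => [Hlj|]; last exact: Z.
case: (boolP (isv s (v + fvec j))) => [Hj|Hj].
  case: (HM) => _ _ _ H _; have := H v l j Hv lj Hl Hj Hlj.
  by move/(congr1 (mulmx u)); rewrite !mulmxA (homog_idem Hu).
rewrite (homog_not_vertex HM (homog_act (i := j) HM Hu) Hj) mul0mx.
move: (Hj); rewrite (isv_fvecP j Hv) negb_forall => /existsP [p].
have := isv_ge0 p Hv; rewrite fvecE -ltNge => vp.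
case: (eqVneq (ordS p) j) => [pj|_]; last by case: (_ == _) => /=; lia.
move=> Hp; have vp0 : v 0 p = 0 by move: Hp; case: (p == j) => /=; lia.
have jp : p != j by rewrite -pj eq_sym ordS_neq.
case: (eqVneq p l) => [pl|pl].
  move: Hc; rewrite -pl pj eqxx orbF => /eqP p0.
  rewrite p0; rewrite p0 in vp0 pj.
  case: (HM) => _ _ _ _ /(_ v Hv vp0) H.
  have -> : j = inord 1.
    by rewrite -pj; apply: val_inj; rewrite /= inordK ?modn_small //.
  by move/(congr1 (mulmx u)): H; rewrite !mulmxA (homog_idem Hu) mulmx0.
have := isv_ge0 p Hlj; rewrite !addvE !fvecE vp0 pj eqxx (negPf pl).
by rewrite (negPf jp); case: (_ == _) => /=; lia.
Qed.

Lemma degmx_mul (M : gmod k n) d e :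
  degmx M d *m degmx M e = if d == e then degmx M d else 0.
Proof.
apply/matrixP => p q; rewrite mxE (bigD1 p) //= big1 ?addr0.
  rewrite !mxE eqxx /=; case: (eqVneq p q) => [<-|]; last first.
    by rewrite mulr0 => pq; case: ifP; rewrite !mxE ?(negPf pq).
  case: (eqVneq (gdeg M p) d) => [E|H] /=; last first.
    by rewrite mul0r; case: ifP; rewrite !mxE ?(negPf H) ?andbF.
  by rewrite mul1r E; case: eqP => _; rewrite !mxE ?eqxx ?E ?eqxx.
by move=> j jp; rewrite !mxE eq_sym (negPf jp) mul0r.
Qed.

Lemma act_degmx (M : gmod k n) i d : is_gmod s M ->
  gact M i *m degmx M d = degmx M (d - 1) *m gact M i.
Proof.
case=> _ H _ _ _; apply/matrixP => p q; rewrite !mxE (bigD1 q) //= big1 ?addr0.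
  rewrite [RHS](bigD1 p) //= big1 ?addr0.
    rewrite !mxE !eqxx /=; case: (eqVneq (gact M i p q) 0) => [->|/H [_ E]].
      by rewrite mulr0 mul0r.
    by rewrite mulrC E; congr (_%:R * _); lia.
  by move=> j jp; rewrite !mxE eq_sym (negPf jp) mul0r.
by move=> j jq; rewrite !mxE (negPf jq) mulr0.
Qed.

(** Induction on the degree: expanding the identity by the generation hypothesis expresses the
    projector to degree e > d through the arrows and the projector to degree e - 1. *)
Lemma generated_full (M : gmod k n) d m (W : 'M[k]_(m, gdim M)) :
  is_gmod s M -> gen_in_deg M d -> (degmx M d <= W)%MS ->
  (forall i, (W *m gact M i <= W)%MS) -> row_full W.
Proof.
move=> HM [Hd Hg] H0 HW.
have [[X Y] E] := sub_addsmxP (submx_full (1%:M : 'M[k]_(gdim M)) Hg).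
have [Z2 EZ2] : exists Z2 : 'I_n.+1 -> 'M_(gdim M),
    Y *m (\sum_(i < n.+1) gact M i)%MS = \sum_i Z2 i *m gact M i.
  by apply/sub_sumsmxP; exact: submxMl.
rewrite /= EZ2 in E.
have step e : degmx M e = (if d == e then X *m degmx M d else 0)
    + \sum_i Z2 i *m degmx M (e - 1) *m gact M i.
  rewrite -[LHS]mul1mx E mulmxDl -mulmxA degmx_mul mulmx_suml.
  congr (_ + _); first by case: eqP => _; rewrite ?mulmx0.
  by apply: eq_bigr => i _; rewrite -!mulmxA (act_degmx _ _ HM).
have ind (m' : nat) : (degmx M (d + m'%:Z) <= W)%MS.
  elim: m' => [|m' IH]; first by rewrite addr0.
  rewrite step addmx_sub //.
    by case: eqP => _; [apply: submx_trans (submxMl _ _) H0 | exact: sub0mx].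
  apply: summx_sub => i _; apply: submx_trans (HW i); apply: submxMr.
  apply: submx_trans (submxMl _ _) _.
  by have -> : d + m'.+1%:Z - 1 = d + m'%:Z by lia.
rewrite -sub1mx; apply/row_subP => p.
have -> : row p 1%:M = row p (degmx M (d + (`|gdeg M p - d|%N)%:Z)).
  apply/rowP => q; rewrite !mxE; congr (_%:R); rewrite andb_idr // => _.
  by apply/eqP; have := Hd p; lia.
exact: submx_trans (row_sub _ _) (ind _).
Qed.

End Homogeneous.

(** * Modules whose basis consists of commutation classes of paths *)

Section PathModules.
Variables (k : fieldType) (n s : nat) (x : vtxT n).
Hypothesis hx : isv s x.

(** The exponents of interest satisfy c_i <= x_(i-1) <= s, so truncating at s loses nothing and
    keeps the set of words finite. *)
Definition expo := {ffun 'I_n.+1 -> 'I_s.+1}.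
(* A pair (c, S) stands for the path from the vertex x + sum_i c_i f_i using each
   arrow alpha_i, i in S, once; this is well defined up to commutation. *)
Definition pword := (expo * {set 'I_n.+1})%type.

Implicit Types (c : expo) (S : {set 'I_n.+1}) (i j : 'I_n.+1) (u : pword).

Definition mult (c : expo) (S : {set 'I_n.+1}) p : nat := (c p + (p \in S))%N.

(* The end vertex x + sum_i (c_i + [i in S]) f_i of (c, S): alpha_i moves one unit
   from the cyclic predecessor of i to i. *)
Definition vt (c : expo) S : vtxT n :=
  \row_p (x 0 p + (mult c S p)%:Z - (mult c S (ordS p))%:Z).

Definition dg (c : expo) S : nat := (\sum_p mult c S p)%N.

Lemma vtE c S p : vt c S 0 p = x 0 p + (mult c S p)%:Z - (mult c S (ordS p))%:Z.
Proof. by rewrite mxE. Qed.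

Lemma isv_vtP c S :
  isv s (vt c S) = [forall p, (mult c S (ordS p))%:Z <= x 0 p + (mult c S p)%:Z].
Proof.
rewrite /isv; under [\sum_j _]eq_bigr => j _ do rewrite vtE.
rewrite sumrB big_split /= [X in _ + X - _](reindex_inj (@ordS_inj n.+1)) addrK.
case/andP: hx => _ ->; rewrite andbT; apply: eq_forallb => p.
by rewrite vtE subr_ge0.
Qed.

Lemma mult_add c S i p : i \notin S -> mult c (i |: S) p = (mult c S p + (p == i))%N.
Proof.
move=> iS; rewrite /mult !inE; case: eqVneq => [->|_] /=; last by rewrite addn0.
by rewrite (negPf iS) addn0.
Qed.

Lemma vt_add c S i : i \notin S -> vt c (i |: S) = vt c S + fvec i.
Proof.
move=> iS; apply/rowP => p; rewrite addvE !vtE fvecE !mult_add //.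
by rewrite !PoszD; case: (p == i); case: (ordS p == i) => /=; lia.
Qed.

Lemma dg_add c S i : i \notin S -> (dg c (i |: S))%:Z = (dg c S)%:Z + 1.
Proof.
move=> iS; rewrite -PoszD addn1 /dg; congr Posz; under eq_bigr => p _ do rewrite mult_add //.
rewrite big_split /= [X in (_ + X)%N](bigD1 i) //= [X in (_ + (_ + X))%N]big1 ?eqxx ?addn0 ?addn1 //.
by move=> p /negPf ->.
Qed.

Variable ok : pred pword.

(* [bv u] is 0 when [ok u] fails, so that paths outside the chosen basis vanish. *)
Definition bv (u : pword) : 'rV[k]_#|ok| := \row_q (enum_val q == u)%:R.
Definition lin m (f : pword -> 'rV[k]_m) : 'M[k]_(#|ok|, m) :=
  \matrix_(p < #|ok|) f (enum_val p).

Lemma bv_nok u : ~~ ok u -> bv u = 0.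
Proof.
move=> H; apply/rowP => q; rewrite !mxE; case: eqP => // E.
by move: (enum_valP q) H; rewrite E unfold_in => ->.
Qed.

Lemma bv_enum p : bv (enum_val p) = delta_mx 0 p.
Proof. by apply/rowP => q; rewrite !mxE (inj_eq enum_val_inj) eqxx. Qed.

Lemma bv_lin m f u : bv u *m lin (m := m) f = if ok u then f u else 0.
Proof.
case: ifP => [Hu|/negbT /bv_nok ->]; last by rewrite mul0mx.
have uok : u \in ok by [].
by rewrite -(enum_rankK_in uok uok) bv_enum -rowE rowK.
Qed.

Lemma bv_ext m (A B : 'M[k]_(#|ok|, m)) :
  (forall u, ok u -> bv u *m A = bv u *m B) -> A = B.
Proof.
move=> H; apply/row_matrixP => p; rewrite !rowE -bv_enum.
by apply: H; have := enum_valP p.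
Qed.

Lemma bv_sub m m' (A : 'M[k]_(m', #|ok|)) (B : 'M[k]_(m, #|ok|)) :
  (forall u, ok u -> (bv u <= B)%MS) -> (A <= B)%MS.
Proof.
move=> H; apply: submx_trans (submx1 A) _; apply/row_subP => p.
rewrite row1 -bv_enum; apply: H; exact: enum_valP p.
Qed.

Definition pact i (u : pword) := if i \in u.2 then 0 else bv (u.1, i |: u.2).

Definition pmod : gmod k n :=
  @GMod k n #|ok| (fun p => vt (enum_val p).1 (enum_val p).2)
    (fun p => (dg (enum_val p).1 (enum_val p).2)%:Z) (fun i => lin (pact i)).

Lemma bv_act i c S : ok (c, S) ->
  bv (c, S) *m gact pmod i = if i \in S then 0 else bv (c, i |: S).
Proof. by move=> H; rewrite /= bv_lin H. Qed.

Lemma homog_bv c S : @homog k n pmod (vt c S) (dg c S)%:Z (bv (c, S)).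
Proof.
move=> q; rewrite mxE; case: (enum_val q =P (c, S)) => [E _|_]; last by rewrite eqxx.
by rewrite /= E.
Qed.

Lemma bv_idem u v : bv u *m idem pmod v = if vt u.1 u.2 == v then bv u else 0.
Proof.
case: eqP => [<-|N]; first by case: u => c S; rewrite (homog_idem (@homog_bv c S)).
apply/rowP => q; rewrite !mxE big1 // => p _; rewrite !mxE.
case: (enum_val p =P u) => [E|_]; last by rewrite mul0r.
by rewrite /= E; move/eqP/negPf: N => ->; rewrite andbF mulr0.
Qed.

(** Conditions on the surviving words under which [pmod] obeys the relations: [ok_convex] prevents
    one side of a commutation square from vanishing alone, [ok_zero] is the relation at K, and
    alpha_i alpha_i = 0 is built into [pact]. *)
Hypothesis ok_vertex : forall c S, ok (c, S) -> isv s (vt c S).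
Hypothesis ok_convex : forall c S i j, i \notin S -> j \notin S -> i != j ->
  ok (c, S) -> isv s (vt c (i |: S)) -> ok (c, i |: (j |: S)) -> ok (c, i |: S).
Hypothesis ok_zero : forall c S, 0 \notin S -> inord 1 \notin S -> ok (c, S) ->
  vt c S 0 0 = 0 -> ~~ ok (c, inord 1 |: (0 |: S)).

Lemma bv_act2 i j c S : ok (c, S) -> bv (c, S) *m gact pmod i *m gact pmod j =
  if [|| i == j, i \in S, j \in S | ~~ ok (c, i |: S)] then 0
  else bv (c, j |: (i |: S)).
Proof.
move=> H; rewrite bv_act //; case: (boolP (i \in S)) => iS.
  by rewrite mul0mx orbT.
case: (boolP (ok (c, i |: S))) => [Hi|/bv_nok ->]; last by rewrite mul0mx !orbT.
by rewrite bv_act // !inE orbF eq_sym; case: (i == j).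
Qed.

Lemma is_gmod_pmod : is_gmod s pmod.
Proof.
split=> [p|i p q|i|v i j _ ij Hi Hj _|v _ v0].
- by apply: ok_vertex; rewrite -surjective_pairing; have := enum_valP p.
- rewrite -[gact pmod i p q]/(lin (pact i) p q) mxE /pact; case: ifP => iS.
    by rewrite mxE eqxx.
  rewrite mxE; case: (enum_val q =P _) => [E _|]; last by rewrite eqxx.
  by rewrite /= E /= vt_add ?iS // dg_add ?iS.
- apply: (bv_ext (m := #|ok|)) => -[c S] H; rewrite mulmxA bv_act2 // eqxx /=.
  by rewrite mulmx0.
- apply: (bv_ext (m := #|ok|)) => -[c S] H; rewrite !mulmxA bv_idem /=; case: eqP => [E|_]; last first.
    by rewrite !mul0mx.
  rewrite !bv_act2 // [j == i]eq_sym (negPf ij) /=.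
  case: (boolP (i \in S)) => iS; first by rewrite orbT.
  case: (boolP (j \in S)) => jS //=.
  have -> : j |: (i |: S) = i |: (j |: S) by rewrite setUCA.
  rewrite -!E -!vt_add // in Hi Hj.
  case: (boolP (ok (c, i |: (j |: S)))) => [H2|/bv_nok ->]; last by rewrite !if_same.
  rewrite (ok_convex iS jS ij H Hi H2).
  have ji : j != i by rewrite eq_sym.
  by rewrite (@ok_convex c S j i) // setUCA.
- apply: (bv_ext (m := #|ok|)) => -[c S] H; rewrite !mulmxA bv_idem /= mulmx0; case: eqP => [E|_]; last first.
    by rewrite !mul0mx.
  rewrite bv_act2 //; case: ifP => // /norP [_] /norP [S0] /norP [S1 _].
  by apply: bv_nok; apply: ok_zero; rewrite ?E.
Qed.

Lemma is_mor_lin (M : gmod k n) (f : pword -> 'rV[k]_(gdim M)) :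
  (forall c S, ok (c, S) -> @homog k n M (vt c S) (dg c S)%:Z (f (c, S))) ->
  (forall c S i, ok (c, S) -> f (c, S) *m gact M i =
     if (i \notin S) && ok (c, i |: S) then f (c, i |: S) else 0) ->
  is_mor pmod M (lin f).
Proof.
move=> Hh Ha; split=> [p q|i].
  rewrite mxE; case E: (enum_val p) => [c S] H.
  have H2 : ok (c, S) by rewrite -E; have := enum_valP p.
  by have [-> ->] := Hh _ _ H2 _ H; rewrite /= E.
apply: bv_ext => -[c S] H; rewrite !mulmxA bv_act // bv_lin H Ha //.
by case: ifP => iS; rewrite ?mul0mx //= bv_lin.
Qed.

End PathModules.

(** * Homogeneous components and their compatibility with morphisms *)

Section Projectors.
Variables (k : fieldType) (n : nat).

Lemma homog_degmx (M : gmod k n) v d u : @homog k n M v d u -> u *m degmx M d = u.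
Proof.
move=> Hu; apply/rowP => q; rewrite mxE (bigD1 q) //= big1 ?addr0.
  rewrite mxE eqxx /=; case: eqP => [_|H]; first by rewrite mulr1.
  by rewrite mulr0; apply/esym/eqP; apply: contra_notT H => /Hu [].
by move=> p /negPf pq; rewrite mxE pq mulr0.
Qed.

Lemma homog_proj (M : gmod k n) v d u : @homog k n M v d (u *m idem M v *m degmx M d).
Proof.
move=> q; rewrite mxE => H.
have [p] : exists p, (u *m idem M v) 0 p * degmx M d p q != 0.
  apply/existsP; apply: contraNT H; rewrite negb_exists => /forallP H.
  by rewrite big1 // => p _; apply/eqP; have := H p; rewrite negbK.
rewrite mulf_eq0 negb_or [degmx _ _ _ _]mxE => /andP[H1].
case: (eqVneq p q) => [pq|]; last by rewrite eqxx.
case: (eqVneq (gdeg M p) d) => [<- _|]; last by rewrite eqxx.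
rewrite -pq; split=> //; move: H1; rewrite mxE => H1.
have [p'] : exists p', u 0 p' * idem M v p' p != 0.
  apply/existsP; apply: contraNT H1; rewrite negb_exists => /forallP H1.
  by rewrite big1 // => p' _; apply/eqP; have := H1 p'; rewrite negbK.
rewrite mulf_eq0 negb_or [idem _ _ _ _]mxE => /andP[_].
case: (eqVneq p' p) => [->|]; last by rewrite eqxx.
by case: (eqVneq (gvtx M p) v) => //; rewrite eqxx.
Qed.

Lemma mor_idem (M1 M2 : gmod k n) F v : is_mor M1 M2 F ->
  idem M1 v *m F = F *m idem M2 v.
Proof.
case=> H _; apply/matrixP => p q; rewrite !mxE (bigD1 p) //= big1 ?addr0.
  rewrite [RHS](bigD1 q) //= big1 ?addr0.
    rewrite !mxE !eqxx /=; case: (eqVneq (F p q) 0) => [->|/H [-> _]].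
      by rewrite mulr0 mul0r.
    by rewrite mulrC.
  by move=> j jp; rewrite !mxE (negPf jp) mulr0.
by move=> j jq; rewrite !mxE eq_sym (negPf jq) mul0r.
Qed.

Lemma mor_degmx (M1 M2 : gmod k n) F d : is_mor M1 M2 F ->
  degmx M1 d *m F = F *m degmx M2 d.
Proof.
case=> H _; apply/matrixP => p q; rewrite !mxE (bigD1 p) //= big1 ?addr0.
  rewrite [RHS](bigD1 q) //= big1 ?addr0.
    rewrite !mxE !eqxx /=; case: (eqVneq (F p q) 0) => [->|/H [_ ->]].
      by rewrite mulr0 mul0r.
    by rewrite mulrC.
  by move=> j jp; rewrite !mxE (negPf jp) mulr0.
by move=> j jq; rewrite !mxE eq_sym (negPf jq) mul0r.
Qed.

Lemma is_mor_comp (M1 M2 M3 : gmod k n) F G :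
  is_mor M1 M2 F -> is_mor M2 M3 G -> is_mor M1 M3 (F *m G).
Proof.
move=> [HF AF] [HG AG]; split=> [p q|i]; last by rewrite mulmxA AF -!mulmxA AG.
rewrite mxE => H.
have [j] : exists j, F p j * G j q != 0.
  apply/existsP; apply: contraNT H; rewrite negb_exists => /forallP H.
  by rewrite big1 // => j _; apply/eqP; have := H j; rewrite negbK.
by rewrite mulf_eq0 negb_or => /andP[/HF [-> ->] /HG].
Qed.

End Projectors.

(** * The terms of the complex: generation and projectivity *)

Section Koszul.
Variables (k : fieldType) (n s : nat) (x : vtxT n).
Hypotheses (hn : (0 < n)%N) (hx : isv s x).
Implicit Types (c : expo n s) (S T : {set 'I_n.+1}) (i j l : 'I_n.+1).

Definition gen_ok (c : expo n s) : bool :=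
  (c 0 == 0 :> nat) && [forall p, (c (ordS p))%:Z <= x 0 p].

(* The bound at 0 says that the path in S without alpha_0 also ends at a vertex;
   the relation e_z alpha_0 alpha_1 = 0 for z_0 = 0 is what rules out the rest. *)
Definition word_ok (c : expo n s) (S : {set 'I_n.+1}) : bool :=
  ((mult c S (ordS 0))%:Z <= x 0 0) && isv s (vt x c S).

(* Basis of the r-th term of the resolution: the direct sum of the projectives at
   x + sum_i c_i f_i over the exponents c with |c| = r. *)
Definition kos_ok (r : nat) (u : pword n s) : bool :=
  [&& (\sum_p u.1 p == r)%N, gen_ok u.1 & word_ok u.1 u.2].

Definition Kos r := pmod k x (kos_ok r).

Lemma bv_degmx ok c S : bv k ok (c, S) *m degmx (pmod k x ok) (dg c S)%:Z = bv k ok (c, S).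
Proof. exact: (homog_degmx (@homog_bv k n s x ok c S)). Qed.

Lemma ordS0 : ordS (0 : 'I_n.+1) = inord 1.
Proof. by apply: val_inj; rewrite /= inordK ?modn_small. Qed.

Lemma multU c S i p : (mult c S p <= mult c (i |: S) p)%N.
Proof. by rewrite leq_add2l !inE; case: (p \in S); rewrite ?orbT. Qed.

Lemma mult0 c p : mult c set0 p = c p.
Proof. by rewrite /mult inE addn0. Qed.

Lemma dg_card c S : dg c S = (\sum_p c p + #|S|)%N.
Proof.
rewrite /dg big_split /= -sum1_card; congr addn; rewrite [RHS]big_mkcond /=.
by apply: eq_bigr => p _; case: (p \in S).
Qed.

Lemma is_gmod_Kos r : is_gmod s (Kos r).
Proof.
apply: is_gmod_pmod => //.
- by move=> c S /and3P[_ _ /andP[]].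
- move=> c S i j iS jS ij; rewrite /kos_ok /= => /and3P[-> -> _] Hi /and3P[_ _ /andP[H _]].
  rewrite /word_ok Hi andbT; apply: le_trans H; rewrite lez_nat setUCA; exact: multU.
- move=> c S S0 S1 /and3P[_ /andP[/eqP c0 _] _]; rewrite vtE /mult c0 (negPf S0) => E.
  apply/negP => /and3P[_ _ /andP[]]; rewrite /mult -ordS0 !inE eqxx /=.
  by move: S1; rewrite -ordS0 => /negPf S1; move: E; rewrite S1; lia.
Qed.

(* Paths are traversed in the order alpha_1, ..., alpha_n, alpha_0: with this order
   every prefix of a path with admissible end vertex stays inside the quiver. *)
Definition rk (i : 'I_n.+1) : nat := if i == 0 then n else i.-1.
Definition ordk (m : nat) : 'I_n.+1 := inord (m.+1 %% n.+1).

Lemma ordk_val m : (m <= n)%N -> ordk m = (if m == n then 0%N else m.+1) :> nat.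
Proof.
move=> mn; rewrite inordK ?ltn_mod //; case: eqP => [->|]; first by rewrite modnn.
by move=> H; rewrite modn_small //; lia.
Qed.

Lemma rk_ordk m : (m <= n)%N -> rk (ordk m) = m.
Proof.
move=> mn; rewrite /rk -val_eqE /= ordk_val //.
by case: (eqVneq m n) => [->|].
Qed.

Lemma rk_inj : injective rk.
Proof.
move=> i j; rewrite /rk -!val_eqE /= => H; apply: val_inj; move: H => /=.
by have := ltn_ord i; have := ltn_ord j; do 2 case: eqP => ?; lia.
Qed.

Lemma rk_lt i : (rk i < n.+1)%N.
Proof. by rewrite /rk; have := ltn_ord i; case: eqP => _; lia. Qed.

Lemma rk_ordS p : rk (ordS p) = p.
Proof.
rewrite /rk -val_eqE /=; have := ltn_ord p; rewrite ltnS leq_eqVlt.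
case/orP => [/eqP ->|H]; first by rewrite modnn.
by rewrite modn_small.
Qed.

Definition pre S m := [set i in S | (rk i < m)%N].

Lemma preS S m : (m <= n)%N ->
  pre S m.+1 = if ordk m \in S then ordk m |: pre S m else pre S m.
Proof.
move=> mn; apply/setP => i.
have E : (rk i == m) = (i == ordk m) by rewrite -(inj_eq rk_inj) rk_ordk.
rewrite !inE ltnS leq_eqVlt E; case: ifP => H; rewrite !inE.
  by case: eqVneq => [->|] //=; rewrite H.
by case: eqVneq => [->|] //=; rewrite H.
Qed.

Lemma pre_full S : pre S n.+1 = S.
Proof. by apply/setP => i; rewrite inE rk_lt andbT. Qed.

Lemma ordk_notin_pre S m : (m <= n)%N -> ordk m \notin pre S m.
Proof. by move=> mn; rewrite inE rk_ordk // ltnn andbF. Qed.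

(** A position p != 0 receives its unit through alpha_p (rank p - 1) before losing one through the
    next arrow (rank p). Position 0 is refilled last, which is why [word_ok] bounds it separately.
    Prefixes without the losing arrow are covered by [gen_ok]. *)
Lemma pre_vertex c S m : gen_ok c -> word_ok c S -> isv s (vt x c (pre S m)).
Proof.
move=> /andP[_ /forallP Hc] /andP[H0]; rewrite !(isv_vtP hx) => /forallP HS.
apply/forallP => p; have := HS p; have := Hc p; rewrite /mult !inE rk_ordS.
case: (eqVneq p 0) => [p0|p0].
  have {H0} : (mult c S (ordS p))%:Z <= x 0 p by rewrite p0.
  rewrite /mult; case: (ordS p \in S); case: (p \in S) => /=;
    by case: (p < m)%N; case: (rk p < m)%N => /=; lia.
have -> : rk p = p.-1 by rewrite /rk (negPf p0).
case: (ordS p \in S); case: (p \in S) => /=;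
  by case: (ltnP p m) => ?; case: (ltnP p.-1 m) => ? /=; lia.
Qed.

Section Paths.
Variables (M : gmod k n) (c : expo n s) (m : 'rV[k]_(gdim M)).
Hypotheses (HM : is_gmod s M) (Hc : gen_ok c).
Hypothesis Hm : @homog k n M (vt x c set0) (dg c set0)%:Z m.

Fixpoint path_upto S (a : nat) : 'rV[k]_(gdim M) :=
  if a is a'.+1 then
    if ordk a' \in S then path_upto S a' *m gact M (ordk a') else path_upto S a'
  else m.

Lemma path_homog S a : (a <= n.+1)%N ->
  @homog k n M (vt x c (pre S a)) (dg c (pre S a))%:Z (path_upto S a).
Proof.
elim: a => [_|a IH an].
  have -> // : pre S 0 = set0 by apply/setP => i; rewrite !inE andbF.
rewrite preS //=; have {}IH := IH (ltnW an); case: ifP => // _.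
have N := ordk_notin_pre S an.
by rewrite vt_add // dg_add //; exact: (homog_act HM IH).
Qed.

Lemma path_ext S T a : (a <= n.+1)%N -> pre S a = pre T a ->
  path_upto S a = path_upto T a.
Proof.
move=> an /setP E; have {}E i : (rk i < a)%N -> (i \in S) = (i \in T).
  by move=> H; have := E i; rewrite !inE H !andbT.
elim: a an E => //= a IH an E; rewrite E ?rk_ordk // IH //; first exact: ltnW.
by move=> i H; apply: E; apply: ltnW.
Qed.

(** alpha_j is moved left past the arrows of larger rank to its own place. The swap excluded in
    [homog_swap] does not occur: for l != 0 the arrow [ordS l] has larger rank than l, while here j
    has smaller rank. *)
Lemma path_act S a j : word_ok c S -> (a <= n.+1)%N -> (rk j < a)%N ->
  path_upto S a *m gact M j = if j \in S then 0 else path_upto (j |: S) a.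
Proof.
move=> HS; elim: a => //= a IH an ja; set l := ordk a.
have la : rk l = a by exact: rk_ordk.
have an' : (a <= n.+1)%N := ltnW an.
case: (eqVneq j l) => [->|jl].
  rewrite !inE eqxx /=; case: ifP => lS.
    by rewrite -mulmxA; case: HM => _ _ -> _ _; rewrite mulmx0.
  congr (_ *m _); apply: path_ext => //; apply/setP => i; rewrite !inE.
  by case: eqVneq => [->|] //=; rewrite la ltnn !andbF.
have {}ja : (rk j < a)%N.
  by move: ja; rewrite ltnS leq_eqVlt -la (inj_eq rk_inj) (negPf jl).
rewrite !inE [l == j]eq_sym (negPf jl) /=; case: (boolP (l \in S)) => lS; last exact: IH.
have Hl : isv s (vt x c (pre S a) + fvec l).
  rewrite -vt_add ?ordk_notin_pre //.
  have -> : l |: pre S a = pre S a.+1 by rewrite preS // lS.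
  exact: pre_vertex.
rewrite (homog_swap hn HM (path_homog an') (pre_vertex _ Hc HS) Hl) 1?eq_sym //.
  by rewrite IH //; case: ifP => _; rewrite ?mul0mx.
case: (eqVneq l 0) => //= l0; apply: contraTneq ja => ->.
rewrite rk_ordS -la /rk (negPf l0); have : (l : nat) != 0%N by [].
by lia.
Qed.

(** If the bound at 0 fails, the path leaves the quiver at its very first arrow alpha_1, since
    alpha_0, which alone refills position 0, comes last. *)
Lemma path_not_ok T : ~~ word_ok c T -> path_upto T n.+1 = 0.
Proof.
rewrite negb_and => /orP[H|H]; last first.
  by apply: (homog_not_vertex HM (@path_homog T n.+1 _)); rewrite ?pre_full.
have H1 : path_upto T 1 = 0.
  apply: (homog_not_vertex HM (@path_homog T 1 _)) => //.
  rewrite (isv_vtP hx); apply: contraNN H => /forallP/(_ 0).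
  have r0 : (rk (0 : 'I_n.+1)%R < 1)%N = false by rewrite /rk eqxx ltnNge hn.
  rewrite /mult !inE rk_ordS r0 /= andbT andbF.
  by case/andP: Hc => /eqP -> _; rewrite addr0.
suff H2 a : path_upto T a.+1 = 0 by [].
by elim: a => // a IH; rewrite [LHS]/= -/(path_upto T a.+1) IH mul0mx if_same.
Qed.

End Paths.

Lemma path0 (M : gmod k n) (m : 'rV[k]_(gdim M)) a : path_upto m set0 a = m.
Proof. by elim: a => //= a ->; rewrite inE. Qed.

Arguments path_upto : simpl never.

(** Freeness of [Kos] on the words (c, [set0]): their images can be prescribed at will, subject only
    to vertex and degree. *)
Lemma kos_lift r (M : gmod k n) (m : expo n s -> 'rV[k]_(gdim M)) : is_gmod s M ->
  (forall c, @homog k n M (vt x c set0) (dg c set0)%:Z (m c)) ->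
  is_mor (Kos r) M (lin (kos_ok r) (fun u => path_upto (m u.1) u.2 n.+1)).
Proof.
move=> HM Hm; apply: is_mor_lin => [c S _|c S i /and3P[/= E Hc HS]].
  by rewrite -[S in vt x c S]pre_full -[S in dg c S]pre_full; apply: path_homog.
rewrite /= (path_act HM Hc (Hm c)) ?rk_lt //; case: (boolP (i \in S)) => //= _; rewrite /kos_ok /= E Hc /=.
by case: (boolP (word_ok _ _)) => // H; exact: (path_not_ok HM Hc (Hm c) H).
Qed.

(** Drop the arrow j of largest rank. If j != 0, then [ordS j] has larger rank, so it is not in S
    and the bound on c suffices at position j; if j = 0, the bound at 0 in [word_ok] does. *)
Lemma word_ok_last c S : gen_ok c -> word_ok c S -> S != set0 ->
  exists2 j, j \in S & word_ok c (S :\ j).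
Proof.
move=> /andP[_ /forallP Hc] /andP[H0 HS] /set0Pn [i0 Hi0].
case: (arg_maxnP rk Hi0) => j jS jmax; exists j => //.
have mD p : (mult c (S :\ j) p <= mult c S p)%N.
  by rewrite leq_add2l !inE; case: (p \in S); rewrite ?andbF //; case: (_ != _).
apply/andP; split; first by apply: le_trans H0; rewrite lez_nat.
rewrite (isv_vtP hx); apply/forallP => p.
move: HS; rewrite (isv_vtP hx) => /forallP /(_ p) HS.
case: (eqVneq p j) => [E|pj]; last first.
  have -> : mult c (S :\ j) p = mult c S p by rewrite /mult !inE pj.
  by apply: le_trans HS; rewrite lez_nat.
rewrite E /mult !inE eqxx /= addn0; case: (eqVneq j 0) => [j0|j0].
  by have := mD (ordS j); rewrite j0; move: H0; rewrite /mult !inE; lia.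
have -> : ordS j \in S = false.
  apply/negP => /jmax; rewrite rk_ordS /rk (negPf j0).
  by have : (j : nat) != 0%N by []; lia.
by rewrite andbF addn0; have := Hc j; lia.
Qed.

Lemma kos_gen r : gen_in_deg (Kos r) r%:Z.
Proof.
split=> [p|].
  have /and3P[/eqP E _ _] : kos_ok r (enum_val p) by have := enum_valP p.
  by rewrite /= dg_card E lez_nat leq_addr.
rewrite -sub1mx; apply: (bv_sub (ok := kos_ok r)) => -[c S] H.
have /and3P[/= /eqP E Hc HS] := H.
case: (eqVneq S set0) => [S0|/(word_ok_last Hc HS) [j jS Hj]].
  apply: submx_trans (addsmxSl _ _); rewrite -bv_degmx.
  by rewrite dg_card E S0 cards0 addn0 submxMl.
apply: submx_trans (addsmxSr _ _); apply: (sumsmx_sup j) => //.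
have <- : bv k (kos_ok r) (c, S :\ j) *m gact (Kos r) j = bv k (kos_ok r) (c, S).
  rewrite bv_act ?setD1K //; first by rewrite !inE eqxx.
  by apply/and3P; split=> //=; rewrite E.
exact: submxMl.
Qed.

(** The kernel of F - G is a submodule containing the generators, hence everything. *)
Lemma kos_mor_eq r (M : gmod k n) (F G : 'M[k]_(gdim (Kos r), gdim M)) :
  is_mor (Kos r) M F -> is_mor (Kos r) M G ->
  (forall c, kos_ok r (c, set0) -> bv k (kos_ok r) (c, set0) *m F = bv k (kos_ok r) (c, set0) *m G) ->
  F = G.
Proof.
move=> [_ HF] [_ HG] H.
suff : row_full (kermx (F - G)).
  rewrite -sub1mx => /sub_kermxP; rewrite mul1mx => /eqP.
  by rewrite subr_eq0 => /eqP.
apply: (generated_full (is_gmod_Kos r) (kos_gen r)) => [|i].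
  apply/sub_kermxP/(bv_ext (ok := kos_ok r)) => -[c S] HcS; rewrite mulmxA mulmx0.
  have -> : bv k (kos_ok r) (c, S) *m degmx (Kos r) r%:Z =
      if dg c S == r then bv k (kos_ok r) (c, S) else 0.
    rewrite -[in LHS]bv_degmx -mulmxA  (degmx_mul (Kos r)) eqz_nat.
    by case: eqP => _; rewrite ?bv_degmx ?mulmx0.
  case: eqP; last by rewrite mul0mx.
  have /and3P[/= /eqP E Hc HS] := HcS.
  rewrite dg_card E => /eqP; rewrite -[X in _ == X]addn0 eqn_add2l cards_eq0.
  by move=> /eqP S0; rewrite S0 in HcS *; rewrite mulmxBr H ?subrr.
apply/sub_kermxP; rewrite -mulmxA mulmxBr HF HG -mulmxBl mulmxA mulmx_ker.
by rewrite mul0mx.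
Qed.

Lemma kos_proj r : is_proj s (Kos r).
Proof.
move=> M M' g h HM HM' Hg gfull Hh.
(* [pinvmx g] lifts the image of each generator linearly. Projecting to the right vertex and degree
   makes the lift homogeneous and keeps its image, since g is a morphism and that image is
   homogeneous. *)
pose m c := bv k (kos_ok r) (c, set0) *m h *m pinvmx g
   *m idem M (vt x c set0) *m degmx M (dg c set0)%:Z.
have Hm c : @homog k n M (vt x c set0) (dg c set0)%:Z (m c) by exact: homog_proj.
have HF := kos_lift r HM Hm; exists (lin (kos_ok r) (fun u => path_upto (m u.1) u.2 n.+1)).
split=> //; apply: (kos_mor_eq (is_mor_comp HF Hg) Hh) => c Hc.
have Hb := homog_mor Hh (@homog_bv k n s x (kos_ok r) c set0).
rewrite mulmxA bv_lin Hc path0 /m -mulmxA (mor_degmx _ Hg) mulmxA -(mulmxA _ (idem _ _)).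
rewrite (mor_idem _ Hg) mulmxA mulmxKpV ?submx_full //.
by rewrite (homog_idem Hb) (homog_degmx Hb).
Qed.

End Koszul.

(** * The Koszul differential and its contraction *)

(** The diagonal is assumed to vanish separately because antisymmetry does not force this when V has
    2-torsion, as in characteristic 2. *)
Lemma sum_antisym (V : zmodType) n (F : 'I_n -> 'I_n -> V) :
  (forall i, F i i = 0) -> (forall i j, F i j = - F j i) ->
  \sum_i \sum_j F i j = 0.
Proof.
move=> F0 FN.
have -> : \sum_i \sum_j F i j =
    \sum_(i < n) \sum_(j < n | (j < i)%N) F i j +
    \sum_(i < n) \sum_(j < n | (i < j)%N) F i j.
  rewrite -big_split; apply: eq_bigr => i _ /=.
  rewrite (bigID (fun j : 'I_n => (j < i)%N)) /=; congr (_ + _).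
  rewrite (bigD1 i) ?ltnn //= F0 add0r; apply: eq_bigl => j.
  by rewrite -leqNgt ltn_neqAle eq_sym andbC.
rewrite [X in _ + X](exchange_big_dep xpredT) //= -big_split big1 // => i _ /=.
rewrite -big_split big1 // => j _; rewrite /= FN addNr //.
Qed.

Section Differential.
Variables (k : fieldType) (n s : nat) (x : vtxT n).
Hypotheses (hn : (0 < n)%N) (hx : isv s x).
Implicit Types (c : expo n s) (S T : {set 'I_n.+1}) (i j l p q : 'I_n.+1).

Definition lower c j : expo n s :=
  [ffun l => if l == j then inord (c j).-1 else c l].
(** If c j = s, the successor is out of range and [inord] returns 0; [first_lt] excludes this for
    the basis words to which the homotopy applies it. *)
Definition raise c j : expo n s :=
  [ffun l => if l == j then inord (c j).+1 else c l].

Lemma lowerE c j l : lower c j l = (c l - (l == j))%N :> nat.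
Proof.
rewrite ffunE; case: eqP => [->|_]; last by rewrite subn0.
by rewrite inordK ?subn1 //; have := ltn_ord (c j); lia.
Qed.

Lemma raiseE c j l : (c j < s)%N -> raise c j l = (c l + (l == j))%N :> nat.
Proof.
move=> H; rewrite ffunE; case: eqP => [->|_]; last by rewrite addn0.
by rewrite inordK ?addn1.
Qed.

Lemma expoP c c' : (forall l, c l = c' l :> nat) -> c = c'.
Proof. by move=> H; apply/ffunP => l; apply: ord_inj. Qed.

Lemma mult_lower c S j p : j \notin S -> (0 < c j)%N ->
  mult (lower c j) (j |: S) p = mult c S p.
Proof.
move=> jS c0; rewrite mult_add // /mult lowerE; case: eqVneq => [->|_] /=; lia.
Qed.

Lemma mult_raise c S j p : j \in S -> (c j < s)%N ->
  mult (raise c j) (S :\ j) p = mult c S p.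
Proof.
move=> jS cs; rewrite /mult raiseE // !inE; case: eqVneq => [->|_] /=; last lia.
by rewrite jS addn0.
Qed.

Section MultInvariance.
Variables (c c' : expo n s) (S T : {set 'I_n.+1}).
Hypothesis E : forall p, mult c S p = mult c' T p.

Lemma vt_ext : vt x c S = vt x c' T.
Proof. by apply/rowP => p; rewrite !vtE !E. Qed.

Lemma dg_ext : dg c S = dg c' T.
Proof. by apply: eq_bigr => p _; rewrite E. Qed.

Lemma word_ok_ext : word_ok x c S = word_ok x c' T.
Proof. by rewrite /word_ok vt_ext E. Qed.

End MultInvariance.

Lemma gen_ok_lower c j : gen_ok x c -> gen_ok x (lower c j).
Proof.
case/andP => /eqP c0 /forallP H; rewrite /gen_ok lowerE c0 sub0n eqxx.
by apply/forallP => p; apply: le_trans (H p); rewrite lowerE lez_nat leq_subr.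
Qed.

Lemma sum_lower c j : (0 < c j)%N -> (\sum_l c l = (\sum_l lower c j l).+1)%N.
Proof.
move=> c0; rewrite (bigD1 j) //= [in RHS](bigD1 j) //= lowerE eqxx subn1.
rewrite -addSn prednK //; congr addn; apply: eq_bigr => l /negPf lj.
by rewrite lowerE lj subn0.
Qed.

(** For fixed c + 1_S this is the exterior sign counting the l < j in S, up to a factor depending
    only on j. Written through c alone it is untouched by the arrows, which change only S, so the
    differential is a module map. *)
Definition sgn c j : k := (-1) ^+ (\sum_(l < n.+1 | (l < j)%N) c l).

Lemma sgn_lower c j l : (0 < c j)%N ->
  sgn (lower c j) l = (if (j < l)%N then -1 else 1) * sgn c l.
Proof.
move=> c0; rewrite /sgn; case: ifP => jl; last first.
  rewrite mul1r; congr (_ ^+ _); apply: eq_bigr => q ql; rewrite lowerE.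
  by case: eqVneq => [E|_]; rewrite ?subn0 //; rewrite -E ql in jl.
rewrite [in RHS](bigD1 j) //= [in LHS](bigD1 j) //= lowerE eqxx subn1.
rewrite -{2}(prednK c0) addSn exprS mulrA mulN1r opprK mul1r.
congr (_ ^+ (_ + _)); apply: eq_bigr => q /andP[_ /negPf qj].
by rewrite lowerE qj subn0.
Qed.

Definition dif r (u : pword n s) : 'rV[k]_#|kos_ok x r| :=
  \sum_(j | (j \notin u.2) && (0 < u.1 j)%N)
    sgn u.1 j *: bv k (kos_ok x r) (lower u.1 j, j |: u.2).

Definition kd r : 'M[k]_(#|kos_ok x r.+1|, #|kos_ok x r|) := lin (kos_ok x r.+1) (dif r).

Lemma kos_ok_lower r c S j : j \notin S -> (0 < c j)%N ->
  kos_ok x r.+1 (c, S) -> kos_ok x r (lower c j, j |: S).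
Proof.
move=> jS c0 /and3P[/= /eqP E Hc HS]; apply/and3P; split=> /=.
- by have := sum_lower c0; rewrite E => -[->].
- exact: gen_ok_lower.
- by rewrite (@word_ok_ext _ c _ S) // => p; apply: mult_lower.
Qed.

(** [word_ok] depends only on [mult], which the differential preserves; so products that vanish in
    the source have vanishing image, as [kd_mor] requires. *)
Lemma dif_not_word r c S : ~~ word_ok x c S -> dif r (c, S) = 0.
Proof.
move=> H; rewrite /dif big1 //= => j /andP[jS c0]; rewrite bv_nok ?scaler0 //.
apply: contraNN H => /and3P[_ _] /=.
by rewrite (@word_ok_ext _ c _ S) // => p; apply: mult_lower.
Qed.

Lemma kd_mor r : is_mor (Kos k s x r.+1) (Kos k s x r) (kd r).
Proof.
apply: is_mor_lin => [c S H|c S i H].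
  apply: (big_ind (fun u => @homog k n (Kos k s x r) (vt x c S) (dg c S)%:Z u)).
  - exact: homog0.
  - exact: homog_add.
  - move=> j /= /andP[jS c0]; apply: homog_scale.
    rewrite -(vt_ext (fun p => mult_lower p jS c0)) -(dg_ext (fun p => mult_lower p jS c0)).
    exact: homog_bv.
transitivity (if i \in S then 0 else dif r (c, i |: S)).
  rewrite /dif mulmx_suml /=; case: (boolP (i \in S)) => iS.
    rewrite big1 // => j /andP[jS c0]; rewrite -scalemxAl (bv_act k x i (kos_ok_lower jS c0 H)).
    by rewrite !inE iS orbT scaler0.
  rewrite [LHS]big_mkcond [RHS]big_mkcond; apply: eq_bigr => j _ /=.
  rewrite !inE negb_or; case: (boolP (j \in S)) => jS /=; first by rewrite andbF.
  rewrite andbT; case: ifP => c0; last by rewrite andbF.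
  rewrite -scalemxAl (bv_act k x i (kos_ok_lower jS c0 H)) !inE (negPf iS) orbF andbT.
  by rewrite [j == i]eq_sym; case: eqVneq => _ /=; rewrite ?scaler0 // setUCA.
have /and3P[/= E Hc HS] := H.
case: (i \in S) => //=; rewrite /kos_ok /= E Hc /=.
by case: (boolP (word_ok _ _ _)) => // /dif_not_word ->.
Qed.

Lemma kd_kd r : kd r.+1 *m kd r = 0.
Proof.
apply: bv_ext => -[c S] H; rewrite mulmx0 mulmxA bv_lin H /dif mulmx_suml /=.
(* [F j l] is the term moving j first and l second. Lowering c at j changes the sign at l exactly
   when j < l, so the two orders have opposite signs. *)
pose Q j l := [&& j \notin S, (0 < c j)%N, l \notin S, (0 < c l)%N & j != l].
pose F j l := if Q j l then (sgn c j * ((if (j < l)%N then -1 else 1) * sgn c l)) *: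
   bv k (kos_ok x r) (lower (lower c j) l, l |: (j |: S)) else 0.
rewrite -[RHS](@sum_antisym _ _ F) => [|j|j l]; first last.
- rewrite /F; have -> : Q l j = Q j l.
    rewrite /Q [l == j]eq_sym; case: (l \notin S); case: (j \notin S);
    by case: (0 < c l)%N; case: (0 < c j)%N.
  case: (boolP (Q j l)) => [/and5P[_ _ _ _ jl]|_]; last by rewrite oppr0.
  rewrite -scaleNr setUCA; have -> : lower (lower c j) l = lower (lower c l) j.
    by apply: expoP => q; rewrite !lowerE subnAC.
  congr (_ *: _); have : (j : nat) != l by [].
  by case: ltngtP => // _ _; ring.
- by rewrite /F /Q eqxx !andbF.
rewrite [LHS]big_mkcond; apply: eq_bigr => j _.
case: ifP => [/andP[jS c0]|N]; last first.
  by rewrite big1 // => l _; rewrite /F /Q; case: ifP => // /and3P[H1 H2 _]; rewrite H1 H2 in N.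
rewrite -scalemxAl bv_lin kos_ok_lower // /dif /= scaler_sumr big_mkcond.
apply: eq_bigr => l _; rewrite /F /Q jS c0 !inE negb_or lowerE /= eq_sym.
case: (boolP (l \in S)) => lS /=; first by rewrite andbF.
case: (eqVneq j l) => [->|jl] /=; first by rewrite andbF.
rewrite subn0 andbT; case: ifP => // cl.
by rewrite sgn_lower // scalerA.
Qed.

(* The differential preserves [mult], hence splits into cubes indexed by subsets S;
   [first] is a direction of the cube in which S can be toggled freely, and the
   contracting homotopy [hmt] moves that index from S to c. *)
Definition first c S j : bool :=
  [&& j != 0, (0 < mult c S j)%N &
   [forall l : 'I_n.+1, (l != 0) && (l < j)%N ==> (mult c S l == 0%N)]].

Lemma first_uniq c S i j : first c S i -> first c S j -> i = j.
Proof.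
move=> /and3P[i0 mi /forallP Hi] /and3P[j0 mj /forallP Hj]; apply: ord_inj.
case: (ltngtP i j) => // ij.
  by have := Hj i; rewrite i0 ij /= => /eqP E; rewrite E in mi.
by have := Hi j; rewrite j0 ij /= => /eqP E; rewrite E in mj.
Qed.

Lemma first_exists c S i : i != 0 -> (0 < mult c S i)%N -> exists j, first c S j.
Proof.
move=> i0 mi; have Pi : (i != 0) && (0 < mult c S i)%N by rewrite i0.
case: (@arg_minnP _ i (fun l => (l != 0) && (0 < mult c S l)%N) (@nat_of_ord _) Pi).
move=> j /andP[j0 mj] jmin; exists j; apply/and3P; split=> //.
apply/forallP => l; apply/implyP => /andP[l0 lj]; rewrite -leqn0 leqNgt.
by apply/negP => ml; have := jmin l; rewrite l0 ml leqNgt lj => /(_ isT).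
Qed.

Definition hmt r (u : pword n s) : 'rV[k]_#|kos_ok x r.+1| :=
  if [pick j | first u.1 u.2 j] is Some j then
    if j \in u.2 then bv k (kos_ok x r.+1) (raise u.1 j, u.2 :\ j) else 0
  else 0.

Lemma hmtE r c S j : first c S j ->
  hmt r (c, S) = if j \in S then bv k (kos_ok x r.+1) (raise c j, S :\ j) else 0.
Proof.
rewrite /hmt /= => H; case: pickP => [i /first_uniq/(_ H) -> //|/(_ j)].
by rewrite H.
Qed.

Lemma coord_le p : x 0 p <= s%:Z.
Proof.
case/andP: hx => /forallP H /eqP <-; rewrite (bigD1 p) //= lerDl.
by apply: sumr_ge0 => l _; apply: H.
Qed.

(** Minimality of j pays off here: the multiplicity at a nonzero predecessor is 0, so the vertex
    inequality there becomes the bound. When the predecessor is 0, it is the bound at 0 in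
    [word_ok]. This allows c to be raised at j. *)
Lemma first_bound c S j : gen_ok x c -> word_ok x c S -> first c S j ->
  (mult c S j)%:Z <= x 0 (ord_pred j).
Proof.
move=> Hc /andP[H0]; rewrite (isv_vtP hx) => /forallP HS /and3P[j0 mj /forallP Hj].
case: (eqVneq (ord_pred j) 0) => [E|E].
  by rewrite -{1}(ord_predK j) E.
have v : ord_pred j = j.-1 :> nat.
  by rewrite -(rk_ordS (ord_pred j)) ord_predK /rk (negPf j0).
have := HS (ord_pred j); rewrite ord_predK.
have jpos : (0 < j)%N by rewrite lt0n.
have := Hj (ord_pred j); rewrite E v prednK // leqnn /= => /eqP ->.
by rewrite addr0.
Qed.

Lemma first_lt c S j : gen_ok x c -> word_ok x c S -> first c S j -> j \in S ->
  (c j < s)%N.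
Proof.
move=> Hc HS Hj jS; have := first_bound Hc HS Hj; have := coord_le (ord_pred j).
by rewrite /mult jS; lia.
Qed.

Lemma kos_ok_raise r c S j : first c S j -> j \in S ->
  kos_ok x r (c, S) -> kos_ok x r.+1 (raise c j, S :\ j).
Proof.
move=> Hj jS /and3P[/= /eqP E Hc HS]; have cs := first_lt Hc HS Hj jS.
apply/and3P; split=> /=.
- rewrite (bigD1 j) //= raiseE // eqxx addn1 addSn eqSS -E [X in _ == X](bigD1 j) //=.
  apply/eqP; congr addn; apply: eq_bigr => l /negPf lj.
  by rewrite raiseE // lj addn0.
- have /and3P[j0 _ _] := Hj; have /andP[/eqP c0 /forallP H] := Hc.
  rewrite /gen_ok raiseE // c0 [0 == j]eq_sym (negPf j0) /=; apply/forallP => p.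
  rewrite raiseE //; case: eqVneq => [pj|_]; last by rewrite addn0.
  have := first_bound Hc HS Hj; rewrite /mult jS -pj.
  by rewrite ordSK.
- by rewrite (@word_ok_ext _ c _ S) // => p; apply: mult_raise.
Qed.

Lemma sgn_first c S j : gen_ok x c -> first c S j -> sgn c j = 1.
Proof.
case/andP=> /eqP c0 _ /and3P[_ _ /forallP H]; rewrite /sgn big1 ?expr0 // => l lj.
case: (eqVneq l 0) => [->|l0]; first exact: c0.
by have := H l; rewrite l0 lj /= /mult addn_eq0 => /andP[/eqP].
Qed.

Lemma sgn_raise c j l : (c j < s)%N -> (j < l)%N -> sgn (raise c j) l = - sgn c l.
Proof.
move=> cs jl; rewrite /sgn [in LHS](bigD1 j) //= [in RHS](bigD1 j) //=.
rewrite raiseE // eqxx addn1 addSn exprS mulN1r; congr (- _ ^+ (_ + _)).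
by apply: eq_bigr => q /andP[_ /negPf qj]; rewrite raiseE // qj addn0.
Qed.

Lemma first_min c S j l : gen_ok x c -> first c S j -> (0 < c l)%N -> l != j -> (j < l)%N.
Proof.
case/andP=> /eqP c0 _ /and3P[_ _ /forallP H] cl lj.
have l0 : l != 0 by apply: contraTneq cl => ->; rewrite c0.
rewrite ltn_neqAle eq_sym lj leqNgt; apply/negP => ljt.
have := H l; rewrite l0 ljt /= /mult addn_eq0 => /andP[/eqP E _].
by rewrite E in cl.
Qed.

Lemma lower_raise c j l : (c j < s)%N -> l != j -> lower (raise c j) l = raise (lower c l) j.
Proof.
move=> cs lj; apply: expoP => q; rewrite lowerE !raiseE // ?lowerE.
  case: (eqVneq q l) => [->|_] /=; last by rewrite !subn0.
  by rewrite (negPf lj) !addn0.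
by rewrite eq_sym (negPf lj) subn0.
Qed.

Lemma raise_lower c j : (0 < c j)%N -> raise (lower c j) j = c.
Proof.
move=> c0; apply: expoP => q; rewrite raiseE lowerE ?eqxx; last first.
  by have := ltn_ord (c j); lia.
by case: eqVneq => [->|_]; rewrite /= ?subn0 ?addn0 // subnK.
Qed.

Lemma lower_raiseK c j : (c j < s)%N -> lower (raise c j) j = c.
Proof.
by move=> cs; apply: expoP => q; rewrite lowerE raiseE // addnK.
Qed.

Lemma first_lower c S j l : l \notin S -> (0 < c l)%N -> first c S j ->
  first (lower c l) (l |: S) j.
Proof.
move=> lS cl; rewrite /first mult_lower //; case/and3P => -> -> /= /forallP H.
by apply/forallP => q; rewrite mult_lower //; apply: H.
Qed.

(** Moving j back into S restores the word with sign 1; all other directions exceed j, so raising c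
    at j negates their signs. *)
Lemma hmt_kd r c S j : first c S j -> j \in S -> kos_ok x r (c, S) ->
  hmt r (c, S) *m kd r = bv k (kos_ok x r) (c, S) -
  \sum_(l | (l \notin S) && (0 < c l)%N)
    sgn c l *: bv k (kos_ok x r) (raise (lower c l) j, (l |: S) :\ j).
Proof.
move=> Hj jS H; have /and3P[/= E Hc HS] := H; have cs := first_lt Hc HS Hj jS.
rewrite (hmtE _ Hj) jS bv_lin kos_ok_raise // /dif /= (bigD1 j) /=; last first.
  by rewrite !inE eqxx /= raiseE // eqxx addn1.
rewrite lower_raiseK // setD1K //; congr (_ + _).
  have -> : sgn (raise c j) j = sgn c j.
    congr (_ ^+ _); apply: eq_bigr => l lj; rewrite raiseE //.
    by case: eqVneq lj => [->|_ _]; rewrite ?ltnn ?addn0.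
  by rewrite (sgn_first Hc Hj) scale1r.
rewrite -sumrN big_mkcond [RHS]big_mkcond; apply: eq_bigr => l _.
rewrite !inE raiseE //; case: (eqVneq l j) => [->|lj] /=; first by rewrite andbF jS.
rewrite addn0 andbT; case: ifP => // /andP[lS cl].
rewrite sgn_raise ?(first_min Hc Hj) // scaleNr lower_raise //; congr (- (_ *: bv _ _ (_, _))).
by apply/setP => q; rewrite !inE; case: eqVneq => [->|] //=; rewrite lj.
Qed.

Definition kh r : 'M[k]_(#|kos_ok x r|, #|kos_ok x r.+1|) := lin (kos_ok x r) (hmt r).

(** If j is in S, the sum left over in [hmt_kd] cancels against the homotopy of the differential.
    Otherwise the homotopy kills the word and only the direction j of the differential
    contributes. *)
Lemma kos_homotopy r : 1%:M = kd r *m kh r + kh r.+1 *m kd r.+1.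
Proof.
apply: bv_ext => -[c S] H; rewrite mulmx1 mulmxDr !mulmxA !bv_lin H.
have /and3P[/= /eqP E Hc HS] := H.
(* Since |c| = r + 1 > 0, no word here lies in a degenerate cube. *)
have [i ci] : exists i, (0 < c i)%N.
  apply/existsP; apply: contra_eqT E; rewrite negb_exists => /forallP N.
  by rewrite big1 // => i _; have := N i; rewrite -eqn0Ngt => /eqP.
have i0 : i != 0 by apply: contraTneq ci => ->; case/andP: Hc => /eqP ->.
have [j Hj] : exists j, first c S j.
  by apply: (@first_exists _ _ i) => //; rewrite /mult addn_gt0 ci.
have -> : dif r (c, S) *m kh r = \sum_(l | (l \notin S) && (0 < c l)%N) sgn c l *:
    (if j \in l |: S then bv k (kos_ok x r.+1) (raise (lower c l) j, (l |: S) :\ j) else 0).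
  rewrite /dif mulmx_suml; apply: eq_bigr => l /andP[/= lS cl].
  rewrite -scalemxAl bv_lin kos_ok_lower //; congr (_ *: _).
  by apply: hmtE; apply: first_lower.
case: (boolP (j \in S)) => jS.
  rewrite (hmt_kd Hj jS H) addrC -[LHS]addr0 -addrA; congr (_ + _).
  by rewrite addrC -sumrB big1 // => l _; rewrite !inE jS orbT subrr.
have cj : (0 < c j)%N by case/and3P: Hj => _; rewrite /mult (negPf jS) addn0.
rewrite (hmtE _ Hj) (negPf jS) mul0mx addr0 (bigD1 j) ?jS //= big1 => [|l /andP[_ lj]].
  by rewrite !inE eqxx /= raise_lower // (sgn_first Hc Hj) scale1r addr0 setU1K.
by rewrite !inE (negPf jS) eq_sym (negPf lj) scaler0.
Qed.

End Differential.

(** * Maps between modules given by restricting the set of words *)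

Section Quotients.
Variables (k : fieldType) (n s : nat) (x : vtxT n).

Definition quo (ok ok' : pred (pword n s)) : 'M[k]_(#|ok|, #|ok'|) :=
  lin ok (fun u => bv k ok' u).

(** By the hypothesis, no arrow leads from a killed word to a surviving one, and no product vanishes
    in the source but survives in the target. *)
Lemma quo_mor (ok ok' : pred (pword n s)) :
  (forall c S i, ok (c, S) -> i \notin S -> ok' (c, i |: S) ->
     ok' (c, S) && ok (c, i |: S)) ->
  is_mor (pmod k x ok) (pmod k x ok') (quo ok ok').
Proof.
move=> H; apply: is_mor_lin => [c S _|c S i Hc]; first exact: homog_bv.
case: (boolP (ok' (c, S))) => H'.
  rewrite (bv_act k x i H'); case: (boolP (i \in S)) => //= iS.
  case: ifP => // /negbT N; apply: bv_nok; apply: contraNN N => Hi.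
  by case/andP: (H _ _ _ Hc iS Hi).
rewrite bv_nok // mul0mx; case: (boolP (i \in S)) => //= iS; case: ifP => // _.
rewrite bv_nok //; apply: contraNN H' => Hi.
by case/andP: (H _ _ _ Hc iS Hi).
Qed.

Lemma quo_full (ok ok' : pred (pword n s)) :
  (forall u, ok' u -> ok u) -> row_full (quo ok ok').
Proof.
move=> H; rewrite -sub1mx; apply: bv_sub => u Hu.
have <- : bv k ok u *m quo ok ok' = bv k ok' u by rewrite bv_lin H.
exact: submxMl.
Qed.

End Quotients.

(** * The standard module: augmentation, exactness at the end, recognition *)

Section Standard.
Variables (k : fieldType) (n s : nat) (x : vtxT n).
Hypotheses (hn : (0 < n)%N) (hx : isv s x).
Implicit Types (c : expo n s) (S T B : {set 'I_n.+1}) (i j : 'I_n.+1).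

(* [low_ok [set 0]] selects the standard module (basis e_x, and e_x alpha_0 when
   x + f_0 is a vertex); [low_ok set0] selects its simple top. *)
Definition low_ok B (u : pword n s) : bool :=
  [&& (\sum_p u.1 p == 0)%N, u.2 \subset B & isv s (vt x u.1 u.2)].

Definition Std := pmod k x (low_ok [set 0]).
Definition Simple := pmod k x (low_ok set0).

Definition c0 : expo n s := [ffun=> 0].

Lemma sum_c0 : (\sum_p c0 p = 0)%N.
Proof. by rewrite big1 // => p _; rewrite ffunE. Qed.

Lemma sum_eq0 c : (\sum_p c p == 0)%N -> c = c0.
Proof.
rewrite sum_nat_eq0 => /forallP H; apply: expoP => l; rewrite ffunE /=.
by have := H l => /eqP.
Qed.

Lemma vt_c0 : vt x c0 set0 = x.
Proof. by apply/rowP => p; rewrite vtE !mult0 !ffunE /= addr0 subr0. Qed.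

Lemma low_ok0 B : low_ok B (c0, set0).
Proof. by rewrite /low_ok /= sum_c0 sub0set vt_c0. Qed.

Lemma is_gmod_low B : B \subset [set 0] -> is_gmod s (pmod k x (low_ok B)).
Proof.
move=> B0; apply: is_gmod_pmod => //.
- by move=> c S /and3P[].
- move=> c S i j iS jS ij _ _ /and3P[_ /= /subset_trans/(_ B0) /subsetP H _].
  have := H i; have := H j; rewrite !inE !eqxx !orbT /= => /(_ isT) /eqP j0 /(_ isT) /eqP i0.
  by rewrite i0 j0 eqxx in ij.
- move=> c S _ _ _ _; apply/negP => /and3P[_ /= /subset_trans/(_ B0) /subsetP H _].
  have := H (inord 1); rewrite !inE eqxx => /(_ isT) /eqP.
  by move/(congr1 val); rewrite /= inordK.
Qed.

Lemma low_kos u : low_ok [set 0] u -> kos_ok x 0 u.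
Proof.
case: u => c S /and3P[/= /[dup] /sum_eq0 -> E SB HS]; apply/and3P; split=> //=.
  by rewrite /gen_ok !ffunE /=; apply/forallP => p; rewrite ffunE; apply: isv_ge0 hx.
rewrite /word_ok HS andbT /mult ffunE /=.
have -> : ordS 0 \in S = false.
  by apply/negP => /(subsetP SB); rewrite inE (negPf (ordS_neq _ hn)).
exact: isv_ge0 hx.
Qed.

Lemma kos_low S c : kos_ok x 0 (c, S) -> S \subset [set 0] -> low_ok [set 0] (c, S).
Proof. by case/and3P => /= E _ /andP[_ H] HS; apply/and3P. Qed.

Definition keps : 'M[k]_(#|kos_ok x 0|, #|low_ok [set 0]|) :=
  quo k (kos_ok x 0) (low_ok [set 0]).

Lemma keps_mor : is_mor (Kos k s x 0) Std keps.
Proof.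
apply: quo_mor => c S i Hc iS Hi; rewrite (low_kos Hi) andbT.
case/and3P: Hi => _ /= HS _; apply: kos_low => //.
exact: subset_trans (subsetUr _ _) HS.
Qed.

Lemma keps_full : row_full keps.
Proof. exact: quo_full low_kos. Qed.

Lemma kd_keps : kd k s x 0 *m keps = 0.
Proof.
apply: bv_ext => -[c S] H; rewrite mulmx0 mulmxA bv_lin H /dif mulmx_suml.
rewrite big1 //= => j /andP[jS cj]; rewrite -scalemxAl bv_lin kos_ok_lower //.
rewrite bv_nok ?scaler0 //; apply/negP => /and3P[_ /= /subsetP/(_ j)].
rewrite !inE eqxx /= => /(_ isT) /eqP j0.
by move: H cj => /and3P[_ /andP[/eqP /= E _] _]; rewrite j0 E.
Qed.

(** The first summand uses a section of [keps] that is only linear, which is enough for exactness;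
    it handles the degenerate words with S inside {0}. For the others c = 0 puts the first index in
    S, so [kh] contracts them. *)
Lemma keps_homotopy :
  1%:M = keps *m quo k (low_ok [set 0]) (kos_ok x 0) + kh k s x 0 *m kd k s x 0.
Proof.
apply: bv_ext => -[c S] H; rewrite mulmx1 mulmxDr !mulmxA !bv_lin H.
have cE : c = c0 by apply: sum_eq0; case/and3P: H.
case: (boolP (S \subset [set 0])) => HS.
  rewrite bv_lin kos_low // /hmt; case: pickP => [j /and3P[/= j0]|_]; last first.
    by rewrite mul0mx addr0.
  rewrite cE /mult ffunE /= lt0b => jS.
  by move: (subsetP HS j jS); rewrite inE (negPf j0).
have -> : bv k (low_ok [set 0]) (c, S) = 0.
  by apply: bv_nok; apply: contraNN HS => /and3P[_ /= -> _].
rewrite mul0mx add0r.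
have /subsetPn [i iS] := HS; rewrite inE => i0.
have [j Hj] : exists j, first c S j.
  by apply: (@first_exists _ _ _ _ i) => //; rewrite /mult iS addn1.
have jS : j \in S by case/and3P: Hj => _; rewrite /mult cE ffunE /= lt0b.
rewrite (hmt_kd k hn hx Hj jS H) big1 ?subr0 // => l.
by rewrite cE ffunE andbF.
Qed.

Lemma low_cases B u : B \subset [set 0] -> low_ok B u -> u = (c0, set0) \/ u = (c0, [set 0]).
Proof.
case: u => c S HB /and3P[/= /sum_eq0 -> SB _].
have := subset_trans SB HB; rewrite subset1 => /orP[/eqP ->|/eqP ->]; [right|left]; by [].
Qed.

Lemma vt_c0_loop : vt x c0 [set 0] = x + fvec 0.
Proof. by rewrite -(setU0 [set 0]) vt_add ?vt_c0 ?inE. Qed.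

Lemma std_no_factor : no_factor_above s Std x.
Proof.
move=> p [] /=; have := enum_valP p; rewrite unfold_in.
case/(low_cases (subxx _)) => ->; rewrite ?vt_c0 //= => /qle_coord0.
by rewrite vt_c0_loop addvE fvecE eqxx (negPf (ordS_neq _ hn)) /=; lia.
Qed.

Lemma std_degree0 v (w : 'rV[k]_(gdim Std)) : @homog k n Std v 0 w ->
  exists a, w = a *: bv k (low_ok [set 0]) (c0, set0).
Proof.
move=> Hw; have u0 : (c0, set0) \in low_ok [set 0] by exact: low_ok0.
exists (w 0 (enum_rank_in u0 (c0, set0))); apply/rowP => q; rewrite !mxE.
case: eqP => [E|N]; first by rewrite mulr1; congr (w 0 _); apply: enum_val_inj; rewrite E enum_rankK_in.
rewrite mulr0; apply/eqP; apply: contraT => /Hw [_] /=.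
have := enum_valP q; rewrite unfold_in => /(low_cases (subxx _)) [//|->] /=.
by rewrite dg_card cards1 sum_c0.
Qed.

Section Cover.
Variables (P : gmod k n) (p0 : 'I_(gdim P)).
Hypotheses (HP : is_gmod s P) (Pproj : is_proj s P) (Pgen : gen_in_deg P 0).
Hypotheses (p0deg : gdeg P p0 = 0) (p0uniq : forall p, gdeg P p = 0 -> p = p0).
Hypothesis (p0vtx : gvtx P p0 = x).

Lemma homog_p0 : @homog k n P x 0 (delta_mx 0 p0).
Proof.
move=> q; rewrite mxE eqxx /=; case: (eqVneq q p0) => [->|]; first by [].
by rewrite eqxx.
Qed.

(** P lives in degrees >= 0, so no arrow ends in degree 0 and killing all positive degrees is a
    morphism. *)
Lemma top_map : exists2 h : 'M[k]_(gdim P, gdim Simple),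
  is_mor P Simple h & (delta_mx 0 p0 : 'rV_(gdim P)) *m h != 0.
Proof.
pose b := bv k (low_ok set0) (c0, set0).
pose h : 'M[k]_(gdim P, gdim Simple) :=
  \matrix_(p < gdim P) (if gdeg P p == 0 then b else 0).
have hE p q : h p q = if gdeg P p == 0 then b 0 q else 0.
  by rewrite mxE; case: ifP => //; rewrite mxE.
have act0 i : gact Simple i = 0.
  apply: (bv_ext (m := #|low_ok set0|)) => -[c S] H; rewrite (bv_act k x i H) mulmx0.
  case: ifP => // _; apply: bv_nok; apply/negP => /and3P[_ /= /subsetP/(_ i)].
  by rewrite !inE eqxx => /(_ isT).
exists h; last first.
  have u0 : (c0, set0) \in low_ok set0 by exact: low_ok0.
  apply/eqP => /rowP/(_ (enum_rank_in u0 (c0, set0))); rewrite -rowE !mxE.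
  rewrite p0deg eqxx mxE enum_rankK_in // eqxx => /eqP; by rewrite oner_eq0.
split=> [p q|i].
  rewrite hE; case: (gdeg P p =P 0) => [pd|_]; last by rewrite eqxx.
  rewrite (p0uniq pd) p0vtx p0deg /b => /homog_bv [-> ->].
  by rewrite vt_c0 dg_card sum_c0 cards0.
rewrite act0 mulmx0; apply/matrixP => p q; rewrite !mxE big1 // => r _.
rewrite hE; case: eqP => [rd|_]; last by rewrite mulr0.
case: (eqVneq (gact P i p r) 0) => [->|]; first by rewrite mul0r.
case: HP => _ H _ _ _ /H [_]; have [Hd _] := Pgen; have := Hd p.
by rewrite rd; lia.
Qed.

(** The map to [Simple] lifts to [Std] by projectivity of P; the lift sends [p0] to a nonzero
    multiple of the top, which generates [Std]. *)
Lemma cover_std : exists2 l : 'M[k]_(gdim P, gdim Std), is_mor P Std l & row_full l.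
Proof.
have [h Hh h0] := top_map.
have Hq : is_mor Std Simple (quo k (low_ok [set 0]) (low_ok set0)).
  apply: quo_mor => c S i _ _ /and3P[_ /= /subsetP/(_ i)].
  by rewrite !inE eqxx => /(_ isT).
have Fq : row_full (quo k (low_ok [set 0]) (low_ok set0)).
  apply: quo_full => u /and3P[E S0 V]; rewrite /low_ok E V andbT /=.
  exact: subset_trans S0 (sub0set _).
have [l [Hl lh]] := Pproj (is_gmod_low (subxx _)) (is_gmod_low (sub0set _)) Hq Fq Hh.
exists l => //; have [a Ea] := std_degree0 (homog_mor Hl homog_p0).
have a0 : a != 0.
  apply: contraNneq h0 => a0; rewrite -lh mulmxA Ea a0 scale0r.
  by apply/eqP; exact: mul0mx.
have H1 : (bv k (low_ok [set 0]) (c0, set0) <= l)%MS.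
  have -> : bv k (low_ok [set 0]) (c0, set0) = (a^-1 *: delta_mx 0 p0) *m l.
    by rewrite -scalemxAl Ea scalerA mulVf // scale1r.
  exact: submxMl.
rewrite -sub1mx; apply: (bv_sub (ok := low_ok [set 0])) => u Hu.
have [->|E] := low_cases (subxx _) Hu; first exact: H1.
have <- : bv k (low_ok [set 0]) (c0, set0) *m gact Std 0 = bv k (low_ok [set 0]) u.
  by rewrite (bv_act k x 0 (low_ok0 _)) inE setU0 E.
apply: submx_trans (submxMr _ H1) _; case: Hl => _ <-; exact: submxMl.
Qed.

(* The arrows alpha_i with i != 0 leave x upwards, hence kill the top of D; by
   commutation D is then spanned by its top v and v alpha_0. *)
Lemma std_dim_bound (D : gmod k n) pi : is_gmod s D -> is_mor P D pi -> row_full pi ->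
  no_factor_above s D x -> (gdim D <= gdim Std)%N.
Proof.
move=> HD Hpi Fpi Dx; pose v := (delta_mx 0 p0 : 'rV_(gdim P)) *m pi.
have Hv : @homog k n D x 0 v := homog_mor Hpi homog_p0.
have vA i : i != 0 -> v *m gact D i = 0.
  move=> i0; apply/rowP => q; rewrite [RHS]mxE; apply/eqP; apply: contraT.
  move=> /(homog_act HD Hv) [E _]; case: (Dx q); rewrite E.
  case: HD => /(_ q); rewrite E => Vq _ _ _ _.
  split; first exact: qle_step i0 Vq (qle_refl _).
  move=> /rowP/(_ i); rewrite addvE fvecE eqxx (negPf (ordS_neq _ hn)) /=.
  by lia.
have vAA i : v *m gact D 0 *m gact D i = 0.
  case: (eqVneq i 0) => [->|i0].
    by rewrite -mulmxA; case: HD => _ _ -> _ _; rewrite mulmx0.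
  case: (boolP (isv s (x + fvec 0))) => V.
    by rewrite (homog_swap hn HD Hv hx V) ?vA ?mul0mx // eq_sym.
  by rewrite (homog_not_vertex HD (homog_act HD Hv) V) mul0mx.
pose f : 'M[k]_(gdim Std, gdim D) :=
  lin (low_ok [set 0]) (fun u => if u.2 == set0 then v else v *m gact D 0).
have vf : (v <= f)%MS.
  have <- : bv k (low_ok [set 0]) (c0, set0) *m f = v by rewrite bv_lin low_ok0 eqxx.
  exact: submxMl.
have vAf : (v *m gact D 0 <= f)%MS.
  case: (boolP (isv s (x + fvec 0))) => V; last first.
    by rewrite (homog_not_vertex HD (homog_act HD Hv) V) sub0mx.
  have <- : bv k (low_ok [set 0]) (c0, [set 0]) *m f = v *m gact D 0.
    rewrite bv_lin /low_ok /= sum_c0 subxx vt_c0_loop V /=.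
    by rewrite -cards_eq0 cards1.
  exact: submxMl.
have fA i : (f *m gact D i <= f)%MS.
  apply/row_subP => r; rewrite row_mul rowK; case: ifP => _; last first.
    by rewrite vAA sub0mx.
  by case: (eqVneq i 0) => [->|/vA ->]; rewrite ?sub0mx.
(* This kernel is the preimage under [pi] of the row space of f: a submodule of P containing its
   degree 0 part. *)
have full : row_full (kermx (pi *m cokermx f)).
  apply: (generated_full HP Pgen) => [|i].
    apply/sub_kermxP; rewrite mulmxA; apply/eqP; rewrite -submxE.
    apply/row_subP => p; case: (eqVneq (gdeg P p) 0) => [pd|pd].
      have -> : row p (degmx P 0 *m pi) = v.
        rewrite row_mul (p0uniq pd); congr (_ *m _); apply/rowP => q; rewrite !mxE.
        by rewrite p0deg eqxx andbT eqxx eq_sym.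
      exact: vf.
    have -> : row p (degmx P 0 *m pi) = 0.
      rewrite row_mul; have -> : row p (degmx P 0) = 0; last by rewrite mul0mx.
      by apply/rowP => q; rewrite !mxE (negPf pd) andbF.
    exact: sub0mx.
  apply/sub_kermxP; rewrite mulmxA; apply/eqP; rewrite -submxE.
  case: Hpi => _ HA; rewrite -mulmxA HA mulmxA.
  apply: submx_trans (fA i); apply: submxMr.
  by rewrite submxE -mulmxA mulmx_ker.
have pif : (pi <= f)%MS.
  by rewrite submxE; move: full; rewrite -sub1mx => /sub_kermxP; rewrite mul1mx => ->.
by rewrite -(eqP Fpi); apply: leq_trans (mxrankS pif) (rank_leq_row _).
Qed.

End Cover.

End Standard.

Theorem mainTheorem8 (k : closedFieldType) (n s : nat) (hn : (0 < n)%N) (hs : (0 < s)%N)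
    (x : vtxT n) (hx : isv s x)
    (P D : gmod k n) (pi : 'M[k]_(gdim P, gdim D)) :
  is_Px s P x -> is_std s P x D pi -> has_linear_resolution s D.
Proof.
move=> [HP Pproj Pgen /mem_card1 [p0 Hp0] Px] [HD Hpi Fpi Dx Duniv].
have p0deg : gdeg P p0 = 0 by apply/eqP; have := Hp0 p0; rewrite !inE eqxx.
have p0uniq p : gdeg P p = 0 -> p = p0.
  by move=> pd; apply/eqP; have := Hp0 p; rewrite !inE pd eqxx.
have [l Hl Fl] := cover_std hn hx HP Pproj Pgen p0deg p0uniq (Px _ p0deg).
have HStd := is_gmod_low k hn hx (subxx [set 0]).
(* g is surjective because l is, and then injective by the bound on the dimension of D. *)
have [g [Hg pig]] := Duniv _ l HStd Hl Fl (std_no_factor hn hx).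
have dimD := std_dim_bound hn hx HP Pgen p0deg p0uniq (Px _ p0deg) HD Hpi Fpi Dx.
have rg : (gdim (Std k s x) <= \rank g)%N.
  by have := mxrankM_maxr pi g; rewrite pig (eqP Fl).
have Fg : row_full g by rewrite /row_full eqn_leq rank_leq_col.
have Rg : row_free g.
  by rewrite /row_free eqn_leq rank_leq_row (leq_trans dimD).
(* Lifting [keps] through g yields the augmentation onto D directly, without forming the inverse of
   g as a morphism. *)
have [eps [Heps epsg]] := kos_proj hn hx HD HStd Hg Fg (@keps_mor k _ _ _ hn hx).
exists (Kos k s x), (kd k s x), eps; split.
- move=> i; split; [exact: is_gmod_Kos | split; [exact: kos_proj | exact: kos_gen]].
- by move=> i; apply: kd_mor.
- split=> //; rewrite /row_full eqn_leq rank_leq_col (leq_trans dimD) //.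
  by have := mxrankM_maxl eps g; rewrite epsg (eqP (@keps_full k _ _ _ hn hx)).
- apply/andP; split.
    apply/sub_kermxP; apply: (row_free_inj Rg); rewrite mul0mx -mulmxA epsg.
    exact: kd_keps.
  (* Multiplied by the kernel, the homotopy identity loses its first summand; the second places the
     kernel inside the image of the differential. *)
  rewrite -[kermx eps]mulmx1 (@keps_homotopy k _ _ _ hn hx) mulmxDr mulmxA -epsg.
  rewrite (mulmxA _ eps) mulmx_ker !mul0mx add0r mulmxA; exact: submxMl.
- move=> i; apply/andP; split; first by apply/sub_kermxP; apply: kd_kd.
  rewrite -[kermx _]mulmx1 (@kos_homotopy k _ _ _ hn hx) mulmxDr mulmxA mulmx_ker mul0mx add0r.
  rewrite mulmxA; exact: submxMl.
Qed.
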